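(* Let $\mathcal{A}$ be a finite-dimensional algebra over a field $F$. Then $\mathcal{A}$ is rank-stable.
   Context: Algebras are associative and unital over a field $F$; $F\langle x_1,\dots,x_d\rangle$ denotes the free associative unital algebra (non-commutative polynomials). Every finite-dimensional algebra is finitely presented. For $A\in M_n(F)$ let $\operatorname{rank}(A)=\dim_F\operatorname{Im}A$ and let $\operatorname{rk}(A)=\frac1n\operatorname{rank}(A)$ (normalized rank). For $A\in M_n(F)$, $\widehat{A}$ is the finitely supported $\mathbb{N}\times\mathbb{N}$ matrix that agrees with $A$ in entries $(i,j)$ with $1\le i,j\le n$ and is zero elsewhere. When matrices in $M_n(F)$ are substituted into a non-commutative polynomial, constant terms are interpreted as scalar $n\times n$ matrices. A finitely presented algebra $F\langle x_1,\dots,x_d\rangle/\langle P_1,\dots,P_r\rangle$ is rank-stable if for every $\varepsilon>0$ there exists $\delta>0$ such that for every $n\ge 1$ and every tuple $A_1,\dots,A_d\in M_n(F)$ with $\operatorname{rk}P_i(A_1,\dots,A_d)<\delta$ for all $1\le i\le r$, there exist $n'\ge 1$ and $B_1,\dots,B_d\in M_{n'}(F)$ with $P_i(B_1,\dots,B_d)=0$ for all $1\le i\le r$ and $\operatorname{rank}(\widehat{A_i}-\widehat{B_i})<\varepsilon n$ for all $1\le i\le d$. (This property does not depend on the chosen finite presentation of the algebra.) *)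

(* Defs.v *)
From HB Require Import structures.
From mathcomp Require Import all_boot all_order all_algebra.
From mathcomp Require Import finmap reals.
From mathcomp.multinomials Require Import monalg.

Set Implicit Arguments.
Unset Strict Implicit.
Unset Printing Implicit Defensive.

Import GRing.Theory.
Local Open Scope ring_scope.

(* A unital associative F-algebra, given by its structure morphism from F.
   Unlike [algType F], this includes the zero algebra and the matrix algebras
   'M[F]_n for a variable n. *)
Record algebra (F : fieldType) := Algebra {
  alg_ring :> pzRingType;
  alg_scalar : {rmorphism F -> alg_ring};
  alg_central : forall (c : F) (x : alg_ring),
    alg_scalar c * x = x * alg_scalar c
}.

Definition finite_dimensional (F : fieldType) (A : algebra F) :=
  exists (n : nat) (b : 'I_n -> A), forall x : A, exists c : 'I_n -> F,
    x = \sum_(i < n) alg_scalar A (c i) * b i.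

Definition mx_algebra (F : fieldType) (n : nat) : algebra F :=
  @Algebra F 'M[F]_n (@scalar_mx F n) (fun c M => esym (scalar_mxC c M)).

(* Non-commutative polynomials: the monoid algebra of the free monoid on 'I_d. *)
Notation ncpoly F d := {malg F[{fmonom 'I_d}]}.

Section RankStability.

Variables (F : fieldType) (R : realType).

Definition nceval (A : algebra F) (d : nat) (a : 'I_d -> A)
    (p : ncpoly F d) : A :=
  \sum_(m <- msupp p) alg_scalar A p@_m * \prod_(i <- (m : seq 'I_d)) a i.

Definition in_ideal (d r : nat) (P : 'I_r -> ncpoly F d) (p : ncpoly F d) :=
  exists s : seq (ncpoly F d * 'I_r * ncpoly F d),
    p = \sum_(t <- s) t.1.1 * P t.1.2 * t.2.

(* A is isomorphic to F<x_1, ..., x_d> / <P_1, ..., P_r>: the algebra morphisms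
   from the free algebra are the evaluations, and some evaluation at elements
   of A is surjective with kernel <P_1, ..., P_r>. *)
Definition presents (d r : nat) (P : 'I_r -> ncpoly F d)
    (A : algebra F) :=
  exists a : 'I_d -> A,
    (forall x : A, exists p, nceval a p = x) /\
    (forall p, nceval a p = 0 <-> in_ideal P p).

Definition finitely_presented (A : algebra F) :=
  exists (d r : nat) (P : 'I_r -> ncpoly F d), presents P A.

Definition rk (n : nat) (A : 'M[F]_n) : R := (\rank A)%:R / n%:R.

Definition hat (n : nat) (A : 'M[F]_n) (i j : nat) : F :=
  match insub i, insub j with
  | Some i', Some j' => A i' j'
  | _, _ => 0
  end.

(* The rank of an N x N-indexed matrix supported on the indices below k. *)
Definition corner_rank (k : nat) (M : nat -> nat -> F) : nat :=
  \rank (\matrix_(i < k, j < k) M i j).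

Definition hat_dist (n n' : nat) (A : 'M[F]_n) (B : 'M[F]_n') : nat :=
  corner_rank (maxn n n') (fun i j => hat A i j - hat B i j).

Definition rank_stable_presentation (d r : nat) (P : 'I_r -> ncpoly F d) :=
  forall eps : R, 0 < eps ->
  exists2 delta : R, 0 < delta &
  forall (n : nat) (A : 'I_d -> 'M[F]_n), (0 < n)%N ->
    (forall i, rk (nceval (A := mx_algebra F n) A (P i)) < delta) ->
  exists (n' : nat) (B : 'I_d -> 'M[F]_n'),
    [/\ (0 < n')%N,
        forall i, nceval (A := mx_algebra F n') B (P i) = 0 &
        forall i, (hat_dist (A i) (B i))%:R < eps * n%:R].

(* Rank-stability is independent of the finite presentation; it is required
   here for all of them, and at least one has to exist. *)
Definition rank_stable (A : algebra F) :=
  finitely_presented A /\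
  forall (d r : nat) (P : 'I_r -> ncpoly F d),
    presents P A -> rank_stable_presentation P.

End RankStability.

(* Main.v *)
(* Lift a spanning family b_i of the algebra to polynomials Q_i and let X be a
   tuple of n x n matrices that almost satisfies the relations P_j. Finitely
   many elements of the ideal, namely Q_i x_g - sum_k c_igk Q_k,
   1 - sum_k u_k Q_k and Q_i P_j, have small rank at X, so their common kernel
   W (in the space of row vectors, on which matrices act from the right) has
   small codimension. The span M of the W Q_i contains W, is stable under X, and
   P_j(X) vanishes on M, so M is a module over the algebra. For a nonzero w in W
   the span N of the w Q_i is, likewise, a module, of bounded dimension t > 0.
   Keeping X on M and replacing it by n - dim M copies of N on a complement of M
   in a space of dimension dim M + t (n - dim M) >= n changes X by a matrix of
   rank at most t (n - dim M). For the zero algebra, W != 0 is contradictory: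
   the hypothesis on X is then void for small delta. *)
Require Import Defs.
From HB Require Import structures.
From mathcomp Require Import all_boot all_order all_algebra.
From mathcomp Require Import finmap boolp reals.
From mathcomp.multinomials Require Import monalg.
From mathcomp Require Import zify.

Set Implicit Arguments.
Unset Strict Implicit.
Unset Printing Implicit Defensive.

Import Order.TTheory GRing.Theory Num.Theory.
Local Open Scope ring_scope.

(* Locked because comparing evaluations at distinct variables would otherwise
   unfold the monoid algebra. *)
HB.lock Definition ncvar (F : fieldType) (d : nat) (i : 'I_d) : ncpoly F d :=
  << FMonom [:: i] >>.

(** * Evaluation as an algebra morphism *)

Section Evaluation.

Variables (F : fieldType) (A : algebra F) (d : nat) (a : 'I_d -> A).

Implicit Types p q : ncpoly F d.

(** Words outside the support have coefficient zero; this allows several polynomials to be summed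
    over one common index set. *)
Lemma ncevalEw (E : {fset {fmonom 'I_d}}) p : (msupp p `<=` E)%fset ->
  nceval a p =
    \sum_(m <- E) alg_scalar A p@_m * \prod_(i <- (m : seq 'I_d)) a i.
Proof.
move=> le; rewrite [LHS](big_fset_incl _ le) => //= m _ /mcoeff_outdom ->.
by rewrite rmorph0 mul0r.
Qed.

Lemma ncevalU c (m : {fmonom 'I_d}) :
  nceval a << c *g m >> = alg_scalar A c * \prod_(i <- (m : seq 'I_d)) a i.
Proof. by rewrite (ncevalEw msuppU_le) big_seq_fset1 mcoeffUU. Qed.

Lemma nceval_is_zmod_morphism : zmod_morphism (@nceval F A d a).
Proof.
move=> p q; pose E := (msupp (p - q) `|` (msupp p `|` msupp q))%fset.
have sE : [/\ (msupp (p - q) `<=` E)%fset, (msupp p `<=` E)%fset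
    & (msupp q `<=` E)%fset].
  by split; apply/fsubsetP => m mp; rewrite !in_fsetU mp ?orbT.
case: sE => s1 s2 s3; rewrite !(ncevalEw s1, ncevalEw s2, ncevalEw s3) -sumrB.
by apply: eq_bigr => m _; rewrite mcoeffB rmorphB mulrBl.
Qed.

HB.instance Definition _ :=
  GRing.isZmodMorphism.Build (ncpoly F d) A (@nceval F A d a)
    nceval_is_zmod_morphism.

Lemma nceval_is_monoid_morphism : monoid_morphism (@nceval F A d a).
Proof.
split=> [|p q]; first by rewrite -mpolyC1E ncevalU fm1 big_nil mulr1 rmorph1.
rewrite malgME raddf_sum mulr_suml; apply: eq_bigr => m _.
rewrite raddf_sum mulr_sumr; apply: eq_bigr => m' _.
rewrite [LHS]ncevalU rmorphM fmM big_cat -!mulrA; congr (_ * _).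
by rewrite !mulrA alg_central.
Qed.

HB.instance Definition _ := GRing.isMonoidMorphism.Build (ncpoly F d) A
  (@nceval F A d a) nceval_is_monoid_morphism.

Lemma nceval_var i : nceval a (ncvar F i) = a i.
Proof. by rewrite ncvar.unlock ncevalU rmorph1 mul1r big_seq1. Qed.

Lemma ncevalZ c p : nceval a (c *: p) = alg_scalar A c * nceval a p.
Proof. by rewrite -mul_malgC rmorphM /= ncevalU fm1 big_nil mulr1. Qed.

End Evaluation.

(** * Closure properties of the ideal generated by the relations *)

Section Ideal.

Variables (F : fieldType) (d r : nat) (P : 'I_r -> ncpoly F d).

Lemma in_ideal_gen i : in_ideal P (P i).
Proof. by exists [:: (1, i, 1)]; rewrite big_seq1 mul1r mulr1. Qed.

Lemma in_ideal0 : in_ideal P 0.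
Proof. by exists [::]; rewrite big_nil. Qed.

Lemma in_idealD p q : in_ideal P p -> in_ideal P q -> in_ideal P (p + q).
Proof. by move=> [s ->] [s' ->]; exists (s ++ s'); rewrite big_cat. Qed.

Lemma in_idealM l p q : in_ideal P p -> in_ideal P (l * p * q).
Proof.
move=> [s ->]; exists [seq (l * t.1.1, t.1.2, t.2 * q) | t <- s].
rewrite big_map mulr_sumr mulr_suml; apply: eq_bigr => t _.
by rewrite /= !mulrA.
Qed.

Lemma in_idealMl l p : in_ideal P p -> in_ideal P (l * p).
Proof. by rewrite -[l * p]mulr1; apply: in_idealM. Qed.

Lemma in_idealZ c p : in_ideal P p -> in_ideal P (c *: p).
Proof. by rewrite -mul_malgC; apply: in_idealMl. Qed.

End Ideal.

Lemma mul_gmalgC (F : fieldType) (K : monomType) (c : F) (g : {malg F[K]}) :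
  g * c%:MP = c *: g.
Proof.
rewrite (malgMEw (fsubset_refl _) (msuppC_le c)).
rewrite [RHS](monalgEw (msuppZ_le c g)); apply: eq_bigr => k _.
by rewrite big_seq_fset1 mcoeffC eqxx mulm1 mcoeffZ mulrC.
Qed.

Lemma malg_scalerAr (F : fieldType) (K : monomType) (c : F)
    (g h : {malg F[K]}) :
  g * (c *: h) = c *: (g * h).
Proof. by rewrite -mul_malgC mulrA mul_gmalgC scalerAl. Qed.

(** * Finite-dimensional algebras are finitely presented *)

Section FinitePresentation.

Variables (F : fieldType) (A : algebra F).

Lemma finite_dimensional_basis : finite_dimensional A ->
  exists (n : nat) (b : 'I_n -> A),
    (forall x, exists c : 'I_n -> F, x = \sum_i alg_scalar A (c i) * b i) /\
    (forall c : 'I_n -> F, \sum_i alg_scalar A (c i) * b i = 0 ->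
       forall i, c i = 0).
Proof.
case=> n; elim: n => [|n IHn] [b span_b].
  by exists 0%N, b; split=> // c _ [].
have [free_b|] := pselect (forall c : 'I_n.+1 -> F,
    \sum_i alg_scalar A (c i) * b i = 0 -> forall i, c i = 0).
  by exists n.+1, b.
move/existsNP=> [c /not_implyP[c0 /existsNP[i /eqP ci]]].
have b_i : b i = \sum_j alg_scalar A (- (c i)^-1 * c (lift i j)) * b (lift i j).
  transitivity (alg_scalar A (c i)^-1 * (alg_scalar A (c i) * b i)).
    by rewrite mulrA -rmorphM mulVf // rmorph1 mul1r.
  move: c0; rewrite (bigD1_ord i) //= => /eqP; rewrite addr_eq0 => /eqP ->.
  rewrite mulrN mulr_sumr -sumrN; apply: eq_bigr => j _.
  by rewrite mulNr rmorphN mulNr rmorphM mulrA.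
apply: IHn; exists (fun j => b (lift i j)) => x; have [e ->] := span_b x.
exists (fun j => e (lift i j) - e i * (c i)^-1 * c (lift i j)).
rewrite (bigD1_ord i) //= {1}b_i mulr_sumr -big_split; apply: eq_bigr => j _.
by rewrite /= mulrA -rmorphM -mulrDl -rmorphD mulNr mulrN addrC mulrA.
Qed.

(** The generators are a basis; the relations are its multiplication table ([Some ij]) and the
    expansion of 1 ([None]). *)
Lemma finite_dimensional_fp : finite_dimensional A -> finitely_presented A.
Proof.
move=> /finite_dimensional_basis[n [b [span_b free_b]]].
have [u uE] := span_b 1.
have /choice[mu muE] := fun ij : 'I_n * 'I_n => span_b (b ij.1 * b ij.2).
pose lin (c : 'I_n -> F) : ncpoly F n := \sum_i c i *: ncvar F i.
pose rel (t : option ('I_n * 'I_n)) : ncpoly F n :=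
  if t is Some ij then ncvar F ij.1 * ncvar F ij.2 - lin (mu ij) else 1 - lin u.
pose P (k : 'I_#|{: option ('I_n * 'I_n)}|) := rel (enum_val k).
have rel_ideal t : in_ideal P (rel t).
  by have := in_ideal_gen P (enum_rank t); rewrite /P enum_rankK.
have eval_lin c : nceval b (lin c) = \sum_i alg_scalar A (c i) * b i.
  by rewrite raddf_sum; apply: eq_bigr => i _; rewrite /= ncevalZ nceval_var.
have eval_ideal p : in_ideal P p -> nceval b p = 0.
  move=> [s ->]; rewrite raddf_sum big1 // => t _.
  rewrite /= !rmorphM /= /P; suff -> : nceval b (rel (enum_val t.1.2)) = 0.
    by rewrite mulr0 mul0r.
  case: (enum_val _) => [ij|] /=; rewrite rmorphB /= eval_lin.
    by apply/eqP; rewrite subr_eq0 rmorphM /= !nceval_var (muE ij).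
  by apply/eqP; rewrite rmorph1 subr_eq0 {1}uE.
(* Normal forms: modulo the ideal every polynomial is linear in the variables. The table [mu]
   handles left multiplication by a variable, the unit relation the empty word. *)
pose red p := exists c, in_ideal P (p - lin c).
have redD p q : red p -> red q -> red (p + q).
  move=> [c pc] [e qe]; exists (fun i => c i + e i).
  have -> : lin (fun i => c i + e i) = lin c + lin e.
    by rewrite -big_split; apply: eq_bigr => i _; rewrite scalerDl.
  by rewrite opprD addrACA; exact: (in_idealD pc qe).
have redZ a p : red p -> red (a *: p).
  move=> [c pc]; exists (fun i => a * c i).
  have -> : lin (fun i => a * c i) = a *: lin c.
    by rewrite scaler_sumr; apply: eq_bigr => i _; rewrite scalerA.
  by rewrite -scalerBr; exact: (in_idealZ a pc).
have lin0 : lin (fun=> 0) = 0 by rewrite /lin big1 // => i _; rewrite scale0r.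
have red_ideal p : in_ideal P p -> red p.
  by move=> Pp; exists (fun=> 0); rewrite lin0 subr0.
have red_sum (I : Type) (s : seq I) (p : I -> ncpoly F n) :
    (forall i, red (p i)) -> red (\sum_(i <- s) p i).
  by move=> rp; apply: big_ind => //; apply: red_ideal; apply: in_ideal0.
have redX i p : red p -> red (ncvar F i * p).
  move=> [c pc]; rewrite -(subrK (lin c) p) mulrDr; apply: redD.
    exact: (red_ideal _ (in_idealMl _ pc)).
  rewrite mulr_sumr; apply: red_sum => j; rewrite malg_scalerAr; apply: redZ.
  by exists (mu (i, j)); apply: (rel_ideal (Some (i, j))).
have red_all p : red p.
  rewrite [p]monalgE; apply: red_sum => m.
  have -> : << p@_m *g m >> = p@_m *: << m >>.
    by rewrite -mul_malgC malgM_def fgmulUU mul1m mulr1.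
  apply: redZ; case: m => s; elim: s => [|i s IHs].
    by exists u; have := rel_ideal None; rewrite /= -mpolyC1E -fmoneE.
  have -> : << FMonom (i :: s) >> = ncvar F i * << FMonom s >>.
    rewrite ncvar.unlock malgM_def fgmulUU mulr1; congr << 1 *g _ >>.
    by apply/eqP; rewrite fmP fmM.
  exact: redX.
exists n, _, P, b; split=> [x|p].
  by have [c ->] := span_b x; exists (lin c).
split=> [p0|]; last exact: eval_ideal.
(* If [p] evaluates to 0, so does its normal form, whose coefficients then vanish by freeness of the
   basis. *)
have [c pc] := red_all p; have := eval_ideal _ pc.
rewrite rmorphB /= p0 eval_lin sub0r => /eqP; rewrite oppr_eq0 => /eqP c0.
suff -> : p = p - lin c by [].
rewrite -[LHS]subr0; congr (_ - _); rewrite /lin big1 // => i _.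
by rewrite (free_b _ c0) scale0r.
Qed.

End FinitePresentation.

(** * Evaluation at tuples of matrices *)

Section MatrixEvaluation.

Variables (F : fieldType) (d : nat).

Definition mxeval n (X : 'I_d -> 'M[F]_n) (p : ncpoly F d) : 'M[F]_n :=
  nceval (A := mx_algebra F n) X p.

Section Morphism.

Variables (n : nat) (X : 'I_d -> 'M[F]_n).

Lemma mxevalB p q : mxeval X (p - q) = mxeval X p - mxeval X q.
Proof. exact: (rmorphB (nceval (A := mx_algebra F n) X)). Qed.

Lemma mxeval_sum (I : Type) (s : seq I) (p : I -> ncpoly F d) :
  mxeval X (\sum_(i <- s) p i) = \sum_(i <- s) mxeval X (p i).
Proof. exact: (rmorph_sum (nceval (A := mx_algebra F n) X)). Qed.

Lemma mxevalM p q : mxeval X (p * q) = mxeval X p *m mxeval X q.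
Proof. exact: (rmorphM (nceval (A := mx_algebra F n) X)). Qed.

Lemma mxeval1 : mxeval X 1 = 1%:M.
Proof. exact: (rmorph1 (nceval (A := mx_algebra F n) X)). Qed.

Lemma mxevalZ c p : mxeval X (c *: p) = c *: mxeval X p.
Proof. by rewrite /mxeval ncevalZ -mul_scalar_mx. Qed.

Lemma mxeval_var i : mxeval X (ncvar F i) = X i.
Proof. exact: (@nceval_var F (mx_algebra F n) d X i). Qed.

End Morphism.

(** A module morphism commutes with every polynomial, word by word. The rectangular [U] covers
    inclusions of submodules and of direct summands as well as changes of basis. *)
Lemma mxeval_intertwine s n (Z : 'I_d -> 'M[F]_s) (X : 'I_d -> 'M[F]_n)
    (U : 'M[F]_(s, n)) :
  (forall g, U *m X g = Z g *m U) ->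
  forall p, U *m mxeval X p = mxeval Z p *m U.
Proof.
move=> UX p.
pose word k (Y : 'I_d -> 'M[F]_k) (w : seq 'I_d) : 'M[F]_k :=
  \big[mulmx/1%:M]_(i <- w) Y i.
have mxevalE k (Y : 'I_d -> 'M[F]_k) :
    mxeval Y p = \sum_(m <- msupp p) p@_m *: word k Y m.
  by apply: eq_bigr => m _; rewrite -mul_scalar_mx.
rewrite !mxevalE mulmx_sumr mulmx_suml; apply: eq_bigr => m _.
rewrite -scalemxAr -scalemxAl /word; congr (_ *: _).
elim: (m : seq _) => [|i w IHw]; first by rewrite !big_nil mulmx1 mul1mx.
by rewrite !big_cons -[RHS]mulmxA -IHw !mulmxA UX.
Qed.

Lemma mxrank_sum_le (I : Type) (s : seq I) n (B : I -> 'M[F]_n) :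
  (\rank (\sum_(i <- s) B i)%R <= \sum_(i <- s) \rank (B i))%N.
Proof.
elim: s => [|i s IHs]; first by rewrite !big_nil mxrank0.
by rewrite !big_cons (leq_trans (mxrank_add _ _)) // leq_add2l.
Qed.

(** * Ideal elements of small rank and lifted relations *)

Section Relations.

Variables (r : nat) (P : 'I_r -> ncpoly F d).

(** [N] is the number of terms in an expression of [p] by the generators, hence independent of [n]
    and [X]; each term has rank at most that of its [P i]. *)
Lemma rank_mxeval_ideal p : in_ideal P p -> exists N : nat,
  forall n (X : 'I_d -> 'M[F]_n) k,
    (forall i, (\rank (mxeval X (P i)) <= k)%N) ->
  (\rank (mxeval X p) <= N * k)%N.
Proof.
move=> [s ->]; exists (size s) => n X k leXk.
rewrite mxeval_sum (leq_trans (mxrank_sum_le _ _)) //.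
rewrite mulnC -sum1_size big_distrr /=; apply: leq_sum => t _.
rewrite muln1 !mxevalM (leq_trans (mxrankM_maxl _ _)) //.
exact: leq_trans (mxrankM_maxr _ _) (leXk _).
Qed.

(** Intersecting with the kernel of one more element of [L] costs at most [N * k] dimensions; again
    [K] is uniform in [n] and [X]. *)
Lemma large_kernel (L : seq (ncpoly F d)) :
  {in L, forall p, in_ideal P p} -> exists K : nat,
  forall n (X : 'I_d -> 'M[F]_n) k,
    (forall i, (\rank (mxeval X (P i)) <= k)%N) ->
  exists W : 'M[F]_n,
    {in L, forall p, W *m mxeval X p = 0} /\ (n <= \rank W + K * k)%N.
Proof.
elim: L => [_|p L IHL PL].
  by exists 0%N => n X k _; exists 1%:M; rewrite mxrank1 mul0n addn0.
have [q Lq|K HK] := IHL; first by apply: PL; rewrite inE Lq orbT.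
have [|N HN] := @rank_mxeval_ideal p; first by apply: PL; rewrite inE eqxx.
exists (N + K)%N => n X k leXk; have [W [W0 leW]] := HK n X k leXk.
exists (W :&: kermx (mxeval X p))%MS; split.
  move=> q; rewrite inE => /orP[/eqP->|/W0 Wq].
    by apply/sub_kermxP; rewrite capmxSr.
  by apply/sub_kermxP; rewrite (submx_trans (capmxSl _ _)) //; apply/sub_kermxP.
have := mxrank_sum_cap W (kermx (mxeval X p)).
have := rank_leq_col (W + kermx (mxeval X p))%MS.
rewrite mxrank_ker mulnDl; have := HN n X k leXk.
by have := rank_leq_row (mxeval X p); lia.
Qed.

Variable A : algebra F.

(** The linear expansions of [b i * a g] and of 1 hold in the algebra, so their lifts lie in the
    kernel of the evaluation, which is the ideal. *)
Lemma spanning_lifts : finite_dimensional A -> presents P A ->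
  exists (m : nat) (Q : 'I_m -> ncpoly F d)
      (c : 'I_m -> 'I_d -> 'I_m -> F) (u : 'I_m -> F),
    (forall i g, in_ideal P (Q i * ncvar F g - \sum_k c i g k *: Q k)) /\
    in_ideal P (1 - \sum_k u k *: Q k).
Proof.
move=> [m [b span_b]] [a [surj_a ker_a]].
have /choice[Q QE] : forall i, exists q, nceval a q = b i.
  by move=> i; apply: surj_a.
have eval_lin (e : 'I_m -> F) :
    nceval a (\sum_k e k *: Q k) = \sum_k alg_scalar A (e k) * b k.
  by rewrite raddf_sum; apply: eq_bigr => k _; rewrite /= ncevalZ QE.
have /choice[c cE] := fun t : 'I_m * 'I_d => span_b (b t.1 * a t.2).
have [u uE] := span_b 1.
exists m, Q, (fun i g => c (i, g)), u; split=> [i g|]; apply/ker_a.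
  by rewrite rmorphB rmorphM /= nceval_var QE eval_lin (cE (i, g)) subrr.
by rewrite rmorphB rmorph1 /= eval_lin {1}uE subrr.
Qed.

End Relations.

End MatrixEvaluation.

(** * Building modules by spans, restriction, sums and extension *)

Section Representations.

Variables (F : fieldType) (d : nat).

(** The three hypotheses give, in order, stability of the span of the [W Q_i(X)], the inclusion of
    [W] in it, and the vanishing of the [P j] on it. The number [k] of rows is free so that both a
    subspace and a single vector can be used. *)
Lemma stable_span k n m r (X : 'I_d -> 'M[F]_n) (W : 'M[F]_(k, n))
    (P : 'I_r -> ncpoly F d) (Q : 'I_m -> ncpoly F d)
    (c : 'I_m -> 'I_d -> 'I_m -> F) (u : 'I_m -> F) :
    (forall i g, W *m mxeval X (Q i * ncvar F g - \sum_k c i g k *: Q k) = 0) ->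
    W *m mxeval X (1 - \sum_k u k *: Q k) = 0 ->
    (forall i j, W *m mxeval X (Q i * P j) = 0) ->
  exists M : 'M[F]_n,
    [/\ (W <= M)%MS, (\rank M <= m * k)%N, forall g, (M *m X g <= M)%MS
      & forall j, M *m mxeval X (P j) = 0].
Proof.
move=> WQ W1 WP; pose M := (\sum_i <<W *m mxeval X (Q i)>>)%MS.
have lin_sub (e : 'I_m -> F) : (W *m mxeval X (\sum_k e k *: Q k)%R <= M)%MS.
  rewrite mxeval_sum mulmx_sumr summx_sub // => i _.
  rewrite mxevalZ -scalemxAr scalemx_sub // (sumsmx_sup i) //.
  by rewrite genmxE.
exists M; split.
- move: W1; rewrite mxevalB mxeval1 mulmxBr mulmx1 => /eqP.
  by rewrite subr_eq0 => /eqP {1}->.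
- rewrite -[m in (m * _)%N]card_ord -sum_nat_const.
  apply: (big_ind2 (fun (B : 'M_n) b => \rank B <= b)%N)
    => [|B b B' b' leB leB'|i _].
  + by rewrite mxrank0.
  + by rewrite (leq_trans (mxrank_adds_leqif _ _)) // leq_add.
  + by rewrite genmxE rank_leq_row.
- move=> g; rewrite sumsmxMr; apply/sumsmx_subP => i _.
  rewrite (eqmxMr _ (genmxE _)) -mulmxA -(mxeval_var X) -mxevalM.
  move: (WQ i g); rewrite mxevalB mulmxBr => /eqP.
  by rewrite subr_eq0 => /eqP->.
- move=> j; apply/sub_kermxP/sumsmx_subP => i _; rewrite genmxE.
  by apply/sub_kermxP; rewrite -mulmxA -mxevalM.
Qed.

(** [Z] is the action on [M] in the coordinates of [row_base M], whose freeness allows it to be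
    cancelled. *)
Lemma subrepresentation n (X : 'I_d -> 'M[F]_n) (M : 'M[F]_n) :
    (forall g, (M *m X g <= M)%MS) ->
  exists Z : 'I_d -> 'M[F]_(\rank M),
    (forall g, row_base M *m X g = Z g *m row_base M) /\
    (forall p, M *m mxeval X p = 0 -> mxeval Z p = 0).
Proof.
move=> MX.
have /fin_all_exists[Z ZE] : forall g, exists Z,
    row_base M *m X g = Z *m row_base M.
  by move=> g; apply/submxP; rewrite eq_row_base (eqmxMr _ (eq_row_base M)).
exists Z; split=> // p Mp; apply: (row_free_inj (row_base_free M)).
rewrite -(mxeval_intertwine ZE) mul0mx; apply/sub_kermxP.
by rewrite eq_row_base; apply/sub_kermxP.
Qed.

Lemma representation_sum s t (Z : 'I_d -> 'M[F]_s) (T : 'I_d -> 'M[F]_t) :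
  exists D : 'I_d -> 'M[F]_(s + t),
    (forall g, row_mx 1%:M 0 *m D g = Z g *m row_mx 1%:M 0) /\
    (forall p, mxeval Z p = 0 -> mxeval T p = 0 -> mxeval D p = 0).
Proof.
pose D g := block_mx (Z g) 0 0 (T g).
have DZ g : row_mx 1%:M 0 *m D g = Z g *m row_mx 1%:M 0.
  by rewrite mul_row_block mul_mx_row !mul1mx !mul0mx !addr0 mulmx1 mulmx0.
have DT g : row_mx 0 1%:M *m D g = T g *m row_mx 0 1%:M.
  by rewrite mul_row_block mul_mx_row !mul1mx !mul0mx !add0r mulmx1 mulmx0.
exists D; split=> // p Zp Tp; rewrite -[LHS]mul1mx scalar_mx_block.
rewrite [block_mx _ _ _ _]/(col_mx _ _) mul_col_mx.
by rewrite (mxeval_intertwine DZ) (mxeval_intertwine DT) Zp Tp !mul0mx col_mx0.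
Qed.

Lemma representation_multiple e t (T : 'I_d -> 'M[F]_t) :
  exists D : 'I_d -> 'M[F]_(e * t), forall p, mxeval T p = 0 -> mxeval D p = 0.
Proof.
elim: e => [|e [D HD]]; first by exists (fun=> 0) => p _; apply: flatmx0.
have [D' [_ HD']] := representation_sum T D.
by exists D' => p Tp; apply: HD' => //; apply: HD.
Qed.

Lemma extend_subrepresentation n t (X : 'I_d -> 'M[F]_n) (M : 'M[F]_n)
    (T : 'I_d -> 'M[F]_t) :
    (0 < t)%N -> (forall g, (M *m X g <= M)%MS) ->
  exists (n' : nat) (B : 'I_d -> 'M[F]_n'),
    [/\ (n <= n')%N,
        forall p, M *m mxeval X p = 0 -> mxeval T p = 0 -> mxeval B p = 0
      & forall g, (hat_dist (X g) (B g) <= (n - \rank M) * t)%N].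
Proof.
move=> t_gt0 MX; have [Z [ZE Zp]] := subrepresentation MX.
have [D2 D2p] := representation_multiple (n - \rank M) T.
have [D [DZ Dp]] := representation_sum Z D2.
set e := (n - \rank M)%N in D2 D2p D DZ Dp *.
set n' := (\rank M + e * t)%N in D DZ Dp.
have le_n : (n <= n')%N.
  by rewrite -leq_subLR leq_pmulr.
(* [J] embeds row vectors of length [n] by padding with zeros, so [U] below is [M] inside the larger
   space. *)
pose J : 'M[F]_(n, n') := pid_mx n.
have JJ : J *m J^T = 1%:M.
  rewrite tr_pid_mx mul_pid_mx.
  by rewrite minnn (minn_idPr le_n) pid_mx_1.
pose U := row_base M *m J.
have rankU : \rank U = \rank M.
  by rewrite mxrankMfree ?eq_row_base //; apply/row_freeP; exists J^T.
have [L LE] : exists L : 'M[F]_(e * t, n'), (L :=: U^C)%MS.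
  have : \rank U^C%MS = (e * t)%N by rewrite mxrank_compl rankU addKn.
  by move=> <-; exists (row_base U^C%MS); apply: eq_row_base.
pose G : 'M[F]_n' := col_mx U L.
have unitG : G \in unitmx.
  rewrite -row_full_unit -sub1mx.
  rewrite /G -addsmxE (adds_eqmx (eqmx_refl U) LE).
  by rewrite sub1mx addsmx_compl_full.
have UE : U = row_mx 1%:M 0 *m G by rewrite mul_row_col mul1mx mul0mx addr0.
(* In the basis [G], adapted to [U] and a complement, [B] acts as [Z] on [U] and as the copies of
   [T] on the complement. *)
pose B g := invmx G *m D g *m G.
have GB g : G *m B g = D g *m G by rewrite /B -mulmxA mulKVmx.
have UB g : U *m B g = Z g *m U.
  by rewrite {1}UE -mulmxA GB mulmxA DZ -mulmxA -UE.
exists n', B; split=> // [p Mp Tp|g].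
  rewrite -[LHS](mulKmx unitG) (mxeval_intertwine GB) Dp ?mul0mx ?mulmx0 //.
    exact: Zp.
  exact: D2p.
rewrite /hat_dist (maxn_idPr le_n) /corner_rank; set H := (X in \rank X).
have HE : H = \matrix_(i, j) hat (X g) i j - B g.
  apply/matrixP => i j; rewrite [LHS]mxE [RHS]mxE.
  congr (_ + _); rewrite [RHS]mxE //.
  by rewrite /hat !valK.
(* Zero-padding of matrices is compatible with zero-padding of vectors, so the padded [X g] and
   [B g] agree on [U]; their difference then has rank at most [n' - \rank M = e * t]. *)
have JX : J *m (\matrix_(i, j) hat (X g) i j) = X g *m J.
  apply/matrixP => i j; rewrite !mxE.
  rewrite (bigD1 (widen_ord le_n i)) //= big1 => [|k neq_ki]; last first.
    rewrite !mxE ltn_ord andbT; case: eqP => [ik|]; rewrite ?mul0r //.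
    by case/eqP: neq_ki; apply: val_inj.
  rewrite !mxE eqxx ltn_ord mul1r addr0 /hat valK.
  case: insubP => [j' _ j'E|]; last first.
    rewrite -leqNgt => le_nj; rewrite big1 // => k _; rewrite !mxE.
    case: eqP => [kj|_]; rewrite ?mulr0 //.
    by have := ltn_ord k; rewrite kj ltnNge le_nj.
  rewrite (bigD1 j') //= big1 => [|k neq_kj]; last first.
    rewrite !mxE -j'E; case: eqP => [kj|]; rewrite ?mulr0 //.
    by case/eqP: neq_kj; apply: val_inj.
  by rewrite !mxE j'E eqxx /= -j'E ltn_ord mulr1 addr0.
have UH : U *m H = 0.
  by rewrite HE mulmxBr UB -mulmxA JX mulmxA ZE -mulmxA subrr.
have : (\rank U <= \rank (kermx H))%N by apply/mxrankS/sub_kermxP.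
rewrite rankU mxrank_ker; have := rank_leq_row H; rewrite /n'; lia.
Qed.

End Representations.

(** * Choice of [delta] and the final estimate *)

Lemma finite_dimensional_stable_presentation (F : fieldType) (R : realType)
    (A : algebra F) (d r : nat) (P : 'I_r -> ncpoly F d) :
  finite_dimensional A -> presents P A -> rank_stable_presentation R P.
Proof.
move=> fdA presA; have [m [Q [c [u [PQ P1]]]]] := spanning_lifts fdA presA.
pose rel i g := Q i * ncvar F g - \sum_k c i g k *: Q k.
pose L := (1 - \sum_k u k *: Q k) ::
  [seq rel i g | i <- enum 'I_m, g <- enum 'I_d] ++
  [seq Q i * P j | i <- enum 'I_m, j <- enum 'I_r].
have [|K HK] := @large_kernel F d r P L.
  move=> p; rewrite inE mem_cat.
  move=> /orP[/eqP->//|/orP[]] /allpairsP[[i g] [_ _ ->]].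
    exact: PQ.
  exact/in_idealMl/in_ideal_gen.
(* The summand [m * K] bounds the final distance: codimension [K * k] times module dimension [m].
   The summand [K] makes [W] nonzero, and the successor makes [C] positive. The minimum with 1 in
   [delta] gives [C * k < n]. *)
move=> eps eps_gt0; pose C := (m * K + K).+1.
exists (Num.min 1 eps / C%:R).
  by rewrite divr_gt0 ?ltr0n // lt_min ltr01.
move=> n X n_gt0 rkX; have n_gt0R : 0 < n%:R :> R by rewrite ltr0n.
pose k := (\max_(i < r) \rank (mxeval X (P i)))%N.
have k_small : k%:R < Num.min 1 eps / C%:R * n%:R.
  (* Without relations the maximum is 0, so positivity of the bound has to be checked too. *)
  rewrite /k; elim/big_ind: _ => [|a b lta ltb|i _].
  - by rewrite mulr_gt0 // divr_gt0 ?ltr0n // lt_min ltr01.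
  - by rewrite /maxn; case: ifP.
  - by rewrite -ltr_pdivrMr //; exact: rkX.
have Ck : (C * k)%:R < Num.min 1 eps * n%:R.
  by rewrite natrM mulrC -ltr_pdivlMr ?ltr0n // mulrAC.
have [i|W [WL leW]] := HK n X k.
  exact: (leq_bigmax (F := fun i => \rank (mxeval X (P i)))).
have Ck_lt_n : (C * k < n)%N.
  by rewrite -(ltr_nat R) (lt_le_trans Ck) // ler_piMl ?ge_min ?lexx ?ler0n.
have W_neq0 : W != 0 by rewrite -mxrank_eq0; move: Ck_lt_n leW; rewrite /C; nia.
have /rowV0Pn[w sub_wW w_neq0] := W_neq0.
have WQ i g : W *m mxeval X (rel i g) = 0.
  apply: WL; rewrite inE mem_cat; apply/or3P/Or32.
  by apply/allpairsP; exists (i, g); rewrite !mem_enum.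
have W1 : W *m mxeval X (1 - \sum_k u k *: Q k) = 0.
  by apply: WL; rewrite inE eqxx.
have WP i j : W *m mxeval X (Q i * P j) = 0.
  apply: WL; rewrite inE mem_cat; apply/or3P/Or33.
  by apply/allpairsP; exists (i, j); rewrite !mem_enum.
have [M [sub_WM _ MX MP]] := stable_span WQ W1 WP.
(* As a combination of rows of [W], the vector [w] is killed by the same polynomials. *)
have [e wE] := submxP sub_wW.
have w0 p : W *m mxeval X p = 0 -> w *m mxeval X p = 0.
  by move=> Wp; rewrite wE -mulmxA Wp mulmx0.
have [N [sub_wN rankN NX NP]] :=
  stable_span (fun i g => w0 _ (WQ i g)) (w0 _ W1) (fun i j => w0 _ (WP i j)).
have [T [_ Tp]] := subrepresentation NX.
have rankN_gt0 : (0 < \rank N)%N.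
  rewrite lt0n mxrank_eq0; apply: contraNneq w_neq0 => N0.
  by rewrite -submx0 -N0.
have [n' [B [le_n Bp distB]]] := extend_subrepresentation T rankN_gt0 MX.
exists n', B; split=> [|i|g].
- exact: leq_trans n_gt0 le_n.
- exact: (Bp _ (MP i) (Tp _ (NP i))).
- apply: le_lt_trans (lt_le_trans Ck _); last first.
    by rewrite ler_wpM2r ?ler0n // ge_min lexx orbT.
  rewrite ler_nat (leq_trans (distB g)) //.
  have leM : (n - \rank M <= K * k)%N by have := mxrankS sub_WM; lia.
  by rewrite (leq_trans (leq_mul leM rankN)) // /C; nia.
Qed.

Theorem theorem5p1 (F : fieldType) (R : realType) (A : algebra F) :
  finite_dimensional A -> rank_stable R A.
Proof.
move=> fdA; split; first exact: finite_dimensional_fp.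
by move=> d r P; apply: finite_dimensional_stable_presentation.
Qed.
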